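(* Let $\lambda$ be a partition of $n$, let $(\alpha|\beta)$ be a bicomposition of $n$, let $\mathfrak{t}_0$ be a fixed $\lambda$-tableau, and let $\Gamma$ be a fixed left transversal of $\mathfrak{S}_{\alpha|\beta}$ in $\mathfrak{S}_n$. For each $\mathfrak{d}\in\mathcal{R}$, there is a $\mathbb{Z}\mathfrak{S}_n$-module homomorphism $\hat\vartheta_{\mathfrak{d}}\colon S^\lambda_{\mathbb{Z}}\to M_{\mathbb{Z}}(\alpha|\beta)$ given, for all $\lambda$-tableaux $\mathfrak{t}$, by $$\hat\vartheta_{\mathfrak{d}}(e_{\mathfrak{t}})=\sum_{d\in\Gamma}\mathfrak{a}_{\rho_{\mathfrak{t}}^{-1}d,\mathfrak{d}}\,(d\otimes 1\otimes\epsilon),$$ where $\rho_{\mathfrak{t}}=\mathfrak{t}\circ\mathfrak{t}_0^{-1}\in\mathfrak{S}_n$, $$\mathfrak{a}_{\rho_{\mathfrak{t}}^{-1}d,\mathfrak{d}}=\sum_{\substack{\sigma\in C_{\mathfrak{t}_0}:\\ \sigma\rho_{\mathfrak{t}}^{-1}d\in R_{\mathfrak{t}_0}\mathfrak{d}\mathfrak{S}_{\alpha|\beta}}}\mathrm{sgn}(\sigma)\,\varepsilon_{\mathfrak{d}}(\sigma\rho_{\mathfrak{t}}^{-1}d),$$ and $\varepsilon_{\mathfrak{d}}\big(\tau\mathfrak{d}\,\xi_\alpha\xi_\beta^{+|\alpha|}\big)=\mathrm{sgn}(\xi_\beta)$ for $\tau\in R_{\mathfrak{t}_0}$ and $(\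xi_\alpha,\xi_\beta)\in\mathfrak{S}_\alpha\times\mathfrak{S}_\beta$.
   Context: $\mathfrak{S}_n$ is the symmetric group on $\{1,\dots,n\}$ with product given by composition of functions; $n\ge 1$. A composition is a finite sequence of positive integers (the empty one, $\varnothing$, is the composition of $0$); $|\lambda|$ is the sum of the parts; a partition is a weakly decreasing composition. A bicomposition $(\alpha|\beta)$ of $n$ is a pair of compositions with $|\alpha|+|\beta|=n$. For a composition $\mu$ of $m$, $\mathfrak{S}_\mu\le\mathfrak{S}_m$ is the Young subgroup of permutations preserving each of the consecutive blocks of sizes $\mu_1,\mu_2,\dots$ of $\{1,\dots,m\}$. For $\xi\in\mathfrak{S}_m$ and $k\ge0$, $\xi^{+k}$ is the permutation of $\{k+1,\dots,k+m\}$ with $\xi^{+k}(x+k)=\xi(x)+k$ (extended by the identity), and $\mathfrak{S}_\beta^{+|\alpha|}=\{\xi^{+|\alpha|}:\xi\in\mathfrak{S}_\beta\}$. Put $\mathfrak{S}_{\alpha|\beta}=\mathfrak{S}_\alpha\mathfrak{S}_\beta^{+|\alpha|}\cong\mathfrak{S}_\alpha\times\mathfrak{S}_\beta$. A left transversal of $H$ in $G$ is a set of representatives of the left cosets $gH$. The Young diagram is $[\lambda]=\{(i,j):1\le i\le\ell(\lambda),1\le j\le\lambda_i\}$. A $\lambda$-tableau is a bijection $\mathfrak{t}\colon[\lambda]\to\{1,\dots,n\}$; $\mathfrak{S}_n$ acts on $\lambda$-tableaux by $\sigma\cdot\mathfrak{t}=\sigma\circ\mathfrak{t}$. $R_{\mathfrak{t}}$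 (resp. $C_{\mathfrak{t}}$) $\le\mathfrak{S}_n$ is the subgroup of permutations preserving the set of entries of each row (resp. column) of $\mathfrak{t}$. Define $$\mathcal{R}=\{d\in\mathfrak{S}_n: d^{-1}R_{\mathfrak{t}_0}d\cap\mathfrak{S}_{\alpha|\beta}\subseteq\mathfrak{S}_\alpha\}.$$ (For $\mathfrak d\in\mathcal R$ the map $\varepsilon_{\mathfrak d}\colon R_{\mathfrak{t}_0}\mathfrak{d}\mathfrak{S}_{\alpha|\beta}\to\{\pm1\}$ in the claim is well defined.) Modules: $M^\lambda_{\mathbb{Z}}$ is the permutation $\mathbb{Z}\mathfrak{S}_n$-module on the left cosets $\mathfrak{S}_n/\mathfrak{S}_\lambda$. The initial tableau is $\mathfrak{t}^\lambda(i,j)=\lambda_1+\dots+\lambda_{i-1}+j$; $d_{\mathfrak{t}}=\mathfrak{t}\circ(\mathfrak{t}^\lambda)^{-1}$; the polytabloid is $e_{\mathfrak{t}}=\sum_{\sigma\in C_{\mathfrak{t}}}\mathrm{sgn}(\sigma)\,\sigma d_{\mathfrak{t}}\mathfrak{S}_\lambda\in M^\lambda_{\mathbb{Z}}$; the Specht module $S^\lambda_{\mathbb{Z}}$ is the $\mathbb{Z}$-span of all $e_{\mathfrak{t}}$, a $\mathbb{Z}\mathfrak{S}_n$-submodule. The signed permutation module is $M_{\mathbb{Z}}(\alpha|\beta)=\mathrm{Ind}_{\mathfrak{S}_\alpha\times\mathfrak{S}_\beta}^{\mathfrak{S}_n}(\mathbb{Z}\boxtimes\mathrm{sgn})$, where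 $\mathfrak{S}_\alpha\times\mathfrak{S}_\beta$ is identified with $\mathfrak{S}_{\alpha|\beta}$, with $\mathbb{Z}$-basis $\{d\otimes1\otimes\epsilon:d\in\Gamma\}$, where $1$ generates the trivial module and $\epsilon$ the signature module; so $\sigma\cdot(x\otimes1\otimes\epsilon)=\sigma x\otimes1\otimes\epsilon$ and $x\xi_\alpha\xi_\beta^{+|\alpha|}\otimes1\otimes\epsilon=\mathrm{sgn}(\xi_\beta)(x\otimes1\otimes\epsilon)$ for $x,\sigma\in\mathfrak{S}_n$, $(\xi_\alpha,\xi_\beta)\in\mathfrak{S}_\alpha\times\mathfrak{S}_\beta$. *)

(* Defs.v *)
From HB Require Import structures.
From mathcomp Require Import all_boot all_order all_fingroup all_algebra.
From mathcomp Require Import boolp.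

Set Implicit Arguments.
Unset Strict Implicit.
Unset Printing Implicit Defensive.

Import GroupScope GRing.Theory.
Local Open Scope ring_scope.

(** The library's 'S_n composes permutations from left to right; [sym n] is the
    same type with the opposite product, (s * t) i = s (t i), so that products,
    left cosets and conjugates below are those of composition of functions.
    The set permuted is 'I_n = {0, ..., n-1} instead of {1, ..., n}. *)

Definition sym (n : nat) : Type := 'S_n.
HB.instance Definition _ n := Finite.on (sym n).
Identity Coercion perm_of_sym : sym >-> perm_of.

Section SymGroup.
Variable n : nat.
Implicit Types s t u : sym n.

Definition sym_mul s t : sym n := ((t : 'S_n) * (s : 'S_n))%g.
Definition sym_one : sym n := (1 : 'S_n)%g.
Definition sym_inv s : sym n := ((s : 'S_n)^-1)%g.

Fact sym_mulA : associative sym_mul.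
Proof. by move=> s t u; rewrite /sym_mul mulgA. Qed.
Fact sym_mul1 : left_id sym_one sym_mul.
Proof. by move=> s; rewrite /sym_mul mulg1. Qed.
Fact sym_mulV : left_inverse sym_one sym_inv sym_mul.
Proof. by move=> s; rewrite /sym_mul mulgV. Qed.

HB.instance Definition _ :=
  Finite_isGroup.Build (sym n) sym_mulA sym_mul1 sym_mulV.

Lemma symM s t i : (s * t)%g i = s (t i).
Proof. exact: permM. Qed.
Lemma sym1 i : (1 : sym n)%g i = i.
Proof. exact: perm1. Qed.
Lemma symK s : cancel s (s^-1)%g.
Proof. exact: permK. Qed.
Lemma symKV s : cancel (s^-1)%g s.
Proof. exact: permKV. Qed.
Lemma symP s t : s =1 t <-> s = t.
Proof. by split=> [|->] //; move/permP. Qed.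

Definition sgn s : int := (-1) ^+ (odd_perm s).

Lemma sgn1 : sgn 1%g = 1.
Proof. by rewrite /sgn odd_perm1. Qed.
Lemma sgnM s t : sgn (s * t)%g = sgn s * sgn t.
Proof. by rewrite /sgn [odd_perm _]odd_permM signr_addb mulrC. Qed.
Lemma sgnV s : sgn (s^-1)%g = sgn s.
Proof. by rewrite /sgn [odd_perm _]odd_permV. Qed.

Lemma sgnJ s t : sgn (s ^ t)%g = sgn s.
Proof. by rewrite conjgE !sgnM mulrCA -sgnM mulVg sgn1 mulr1. Qed.

(* The permutations preserving every fibre of f; as the fibres are finite,
   this is the same as f (s i) = f i for all i. *)
Definition fibre_stab (T : eqType) (f : 'I_n -> T) : {set sym n} :=
  [set s : sym n | [forall i, f (s i) == f i]].

Fact fibre_stab_group_set (T : eqType) (f : 'I_n -> T) :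
  group_set (fibre_stab f).
Proof.
apply/group_setP; split=> [|s t]; rewrite !inE.
  by apply/forallP=> i; rewrite sym1.
move=> /forallP fs /forallP ft; apply/forallP=> i.
by rewrite symM (eqP (fs _)) ft.
Qed.
Canonical fibre_stab_group (T : eqType) (f : 'I_n -> T) :=
  Group (fibre_stab_group_set f).

End SymGroup.

Definition group_ring (gT : finGroupType) : Type := {ffun gT -> int}.
HB.instance Definition _ gT := GRing.Zmodule.on (group_ring gT).

Section GroupRing.
Variable gT : finGroupType.
Implicit Types a b c : group_ring gT.

Definition gr_mul a b : group_ring gT :=
  [ffun x => \sum_y a y * b (y^-1 * x)%g].
Definition gr_elt (x : gT) : group_ring gT := [ffun y => (y == x)%:R].

Fact gr_mulA : associative gr_mul.
Proof.
move=> a b c; apply/ffunP=> x; rewrite !ffunE.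
under eq_bigr => y _ do rewrite ffunE big_distrr /=.
under [RHS]eq_bigr => z _ do rewrite ffunE big_distrl /=.
rewrite [RHS]exchange_big /=; apply: eq_bigr => y _.
rewrite [RHS](reindex_inj (mulgI y)) /=; apply: eq_bigr => z _.
by rewrite mulrA mulKg invMg mulgA.
Qed.

Fact gr_mul1 : left_id (gr_elt 1%g) gr_mul.
Proof.
move=> a; apply/ffunP=> x; rewrite ffunE (bigD1 1%g) //= big1 => [|y ny].
  by rewrite ffunE eqxx mul1r invg1 mul1g addr0.
by rewrite ffunE (negPf ny) mul0r.
Qed.

Fact gr_mulr1 : right_id (gr_elt 1%g) gr_mul.
Proof.
move=> a; apply/ffunP=> x; rewrite ffunE (bigD1 x) //= big1 => [|y ny].
  by rewrite ffunE mulVg eqxx mulr1 addr0.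
rewrite ffunE -eq_invg_mul invgK; case: eqP => [e|]; last by rewrite mulr0.
by rewrite e eqxx in ny.
Qed.

Fact gr_mulDl : left_distributive gr_mul +%R.
Proof.
move=> a b c; apply/ffunP=> x; rewrite !ffunE -big_split /=.
by apply: eq_bigr => y _; rewrite ffunE mulrDl.
Qed.

Fact gr_mulDr : right_distributive gr_mul +%R.
Proof.
move=> a b c; apply/ffunP=> x; rewrite !ffunE -big_split /=.
by apply: eq_bigr => y _; rewrite ffunE mulrDr.
Qed.

HB.instance Definition _ := GRing.Zmodule_isPzRing.Build (group_ring gT)
  gr_mulA gr_mul1 gr_mulr1 gr_mulDl gr_mulDr.

Lemma gr_elt1 : gr_elt 1%g = 1.
Proof. by []. Qed.

Lemma gr_eltM x y : gr_elt (x * y)%g = gr_elt x * gr_elt y.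
Proof.
apply/ffunP=> z; rewrite !ffunE (bigD1 x) //= big1 => [|u nu].
  by rewrite !ffunE eqxx mul1r addr0 -[in RHS](inj_eq (mulgI x)) mulKVg.
by rewrite !ffunE (negPf nu) mul0r.
Qed.

Lemma gr_sumE a : a = \sum_g gr_elt g *~ a g.
Proof.
apply/ffunP=> x; rewrite sum_ffunE (bigD1 x) //= big1 => [|y ny].
  by rewrite ffunMzE ffunE eqxx addr0 -mulrzr mul1r intz.
by rewrite ffunMzE ffunE eq_sym (negPf ny) mul0rz.
Qed.

End GroupRing.

(* A linear action of G on an abelian group is the same as a ZG-module. *)
HB.factory Record Zmodule_isGroupRingModule (gT : finGroupType) V
    of GRing.Zmodule V := {
  gact : gT -> V -> V;
  gact1 : gact 1%g =1 id;
  gactM : forall g h v, gact (g * h)%g v = gact g (gact h v);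
  gactD : forall g, {morph gact g : u v / u + v}
}.

HB.builders Context gT V of Zmodule_isGroupRingModule gT V.

Definition gscale (a : group_ring gT) (v : V) := \sum_g gact g v *~ a g.

Lemma gact0 g : gact g 0 = 0.
Proof. by apply: (addrI (gact g 0)); rewrite -gactD !addr0. Qed.
Lemma gactN g v : gact g (- v) = - gact g v.
Proof. by apply: (addrI (gact g v)); rewrite -gactD !subrr gact0. Qed.
Lemma gact_mulrn g v k : gact g (v *+ k) = gact g v *+ k.
Proof. by elim: k => [|k IH]; rewrite ?mulr0n ?gact0 // !mulrS gactD IH. Qed.
Lemma gact_mulrz g v k : gact g (v *~ k) = gact g v *~ k.
Proof.
by case: k => k; rewrite ?NegzE ?mulrNz ?gactN -!pmulrn gact_mulrn.
Qed.
Lemma gact_sum g (f : gT -> V) : gact g (\sum_h f h) = \sum_h gact g (f h).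
Proof. exact: (big_morph _ (gactD g) (gact0 g)). Qed.

Lemma gscaleA a b v : gscale a (gscale b v) = gscale (a * b) v.
Proof.
rewrite /gscale.
transitivity (\sum_g \sum_x gact x v *~ (b (g^-1 * x)%g * a g)).
  apply: eq_bigr => g _; rewrite gact_sum mulrz_suml (reindex_inj (mulgI g^-1%g)).
  apply: eq_bigr => x _ /=.
  by rewrite gact_mulrz -gactM mulKVg -mulrzA.
rewrite exchange_big; apply: eq_bigr => x _ /=.
by rewrite ffunE -mulrz_sumr; congr (_ *~ _); apply: eq_bigr => y _; rewrite mulrC.
Qed.
Lemma gscale1 : left_id 1 gscale.
Proof.
move=> v; rewrite /gscale (bigD1 1%g) //= big1 => [|g ng].
  by rewrite ffunE eqxx gact1 addr0.
by rewrite ffunE (negPf ng).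
Qed.
Lemma gscaleDr : right_distributive gscale +%R.
Proof.
move=> a u v; rewrite /gscale -big_split /=.
by apply: eq_bigr => g _; rewrite gactD mulrzDl.
Qed.
Lemma gscaleDl v : {morph gscale^~ v : a b / a + b}.
Proof.
move=> a b; rewrite /gscale -big_split /=.
by apply: eq_bigr => g _; rewrite ffunE mulrzDr.
Qed.

HB.instance Definition _ := GRing.Zmodule_isLmodule.Build (group_ring gT) V
  gscaleA gscale1 gscaleDr gscaleDl.

HB.end.

Lemma sum_gr_elt (gT : finGroupType) (V : zmodType) (F : gT -> V) g :
  \sum_h F h *~ gr_elt g h = F g.
Proof.
rewrite (bigD1 g) //= big1 => [|h nh]; first by rewrite ffunE eqxx addr0.
by rewrite ffunE (negPf nh).
Qed.

Lemma gr_scaleE (gT : finGroupType) (V : lmodType (group_ring gT)) a (v : V) :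
  a *: v = \sum_g (gr_elt g *: v) *~ a g.
Proof.
rewrite [in LHS](gr_sumE a) scaler_suml; apply: eq_bigr => g _.
by rewrite scalerMzl.
Qed.

Section ZSpan.
Variable V : zmodType.

Definition in_Zspan (X : V -> Prop) (v : V) : Prop :=
  exists2 s : seq (int * V), (forall p, p \in s -> X p.2)
                           & v = \sum_(p <- s) p.2 *~ p.1.
Definition Zspan (X : V -> Prop) : {pred V} := [pred v | `[< in_Zspan X v >]].

Variable X : V -> Prop.

Lemma ZspanP v : reflect (in_Zspan X v) (v \in Zspan X).
Proof. exact: asboolP. Qed.

Lemma mem_Zspan v : X v -> v \in Zspan X.
Proof.
move=> Xv; apply/ZspanP; exists [:: (1, v)]; last by rewrite big_seq1.
by move=> p; rewrite inE => /eqP ->.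
Qed.

Fact Zspan_zmod_closed : zmod_closed (Zspan X).
Proof.
split=> [|u v /ZspanP[s Xs ->] /ZspanP[t Xt ->]]; apply/ZspanP.
  by exists [::]; rewrite ?big_nil.
exists (s ++ [seq (- p.1, p.2) | p <- t]) => [p|].
  by rewrite mem_cat => /orP[/Xs //|/mapP[q /Xt Xq ->]].
rewrite big_cat big_map /= -sumrN; congr (_ + _).
by apply: eq_bigr => p _; rewrite mulrNz.
Qed.
HB.instance Definition _ := GRing.isZmodClosed.Build V (Zspan X)
  Zspan_zmod_closed.

End ZSpan.

Lemma Zspan_submod_closed (gT : finGroupType) (V : lmodType (group_ring gT))
    (X : V -> Prop) :
  (forall g v, X v -> X (gr_elt g *: v)) -> submod_closed (Zspan X).
Proof.
move=> GX; split=> [|a u v Xu Xv]; first exact: rpred0.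
apply: rpredD => //; rewrite gr_scaleE; apply: rpred_sum => g _.
apply: rpredMz; case/ZspanP: Xu => s Xs ->.
rewrite scaler_sumr big_seq; apply: rpred_sum => p /Xs Xp.
rewrite -scalerMzr.
by apply: rpredMz; apply: mem_Zspan; apply: GX.
Qed.

Section PermutationModule.
Variables (gT : finGroupType) (H : {set gT}).

Definition left_coset : Type :=
  {A : {set gT} | A \in lcosets H [set: gT]}.
HB.instance Definition _ := Finite.on left_coset.

Fact lcoset_subproof x : (x *: H)%g \in lcosets H [set: gT].
Proof. by apply/lcosetsP; exists x. Qed.
Definition coset_of_elt x : left_coset := Sub (x *: H)%g (lcoset_subproof x).

Fact lcoset_act_subproof g (A : left_coset) :
  (g *: val A)%g \in lcosets H [set: gT].
Proof.
have /lcosetsP[x _ ->] := valP A; apply/lcosetsP; exists (g * x)%g => //.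
by rewrite lcosetM.
Qed.
Definition lcoset_act g (A : left_coset) : left_coset :=
  Sub (g *: val A)%g (lcoset_act_subproof g A).

Fact lcoset_act1 A : lcoset_act 1%g A = A.
Proof. by apply: val_inj; rewrite /= lcoset1. Qed.
Fact lcoset_actM g h A : lcoset_act (g * h)%g A = lcoset_act g (lcoset_act h A).
Proof. by apply: val_inj; rewrite /= lcosetM. Qed.

Definition perm_module : Type := {ffun left_coset -> int}.
HB.instance Definition _ := GRing.Zmodule.on perm_module.

Definition pm_act g (f : perm_module) : perm_module :=
  [ffun A => f (lcoset_act g^-1%g A)].
Fact pm_act1 : pm_act 1%g =1 id.
Proof. by move=> f; apply/ffunP=> A; rewrite ffunE invg1 lcoset_act1. Qed.
Fact pm_actM g h f : pm_act (g * h)%g f = pm_act g (pm_act h f).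
Proof. by apply/ffunP=> A; rewrite !ffunE invMg lcoset_actM. Qed.
Fact pm_actD g : {morph pm_act g : u v / u + v}.
Proof. by move=> u v; apply/ffunP=> A; rewrite !ffunE. Qed.
HB.instance Definition _ := Zmodule_isGroupRingModule.Build gT perm_module
  pm_act1 pm_actM pm_actD.

Definition pm_basis (x : gT) : perm_module :=
  [ffun A => (A == coset_of_elt x)%:R].

Lemma scale_pm_basis g x : gr_elt g *: pm_basis x = pm_basis (g * x)%g.
Proof.
transitivity (pm_act g (pm_basis x)).
  exact: (sum_gr_elt (fun h => pm_act h (pm_basis x))).
apply/ffunP=> A; rewrite !ffunE; congr (nat_of_bool _)%:R.
have actK : cancel (lcoset_act g) (lcoset_act g^-1%g).
  by move=> B; rewrite -lcoset_actM mulVg lcoset_act1.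
rewrite -(inj_eq (can_inj actK)) -lcoset_actM mulgV lcoset_act1.
by congr (_ == _); apply: val_inj; rewrite /= -lcosetM.
Qed.

End PermutationModule.

Definition composition (mu : seq nat) := 0%N \notin mu.

Record intpart (n : nat) := IntPart {
  parts :> seq nat;
  parts_composition : composition parts;
  parts_sorted : sorted geq parts;
  sumn_parts : sumn parts = n }.

Record bicomp (n : nat) := Bicomp {
  bc1 : seq nat;
  bc2 : seq nat;
  bc1_composition : composition bc1;
  bc2_composition : composition bc2;
  sumn_bc : (sumn bc1 + sumn bc2)%N = n }.

(* [reshape_index mu i] is the index of the block of mu containing i. *)
Definition young (m : nat) (mu : seq nat) : {set sym m} :=
  fibre_stab (fun i : 'I_m => reshape_index mu i).
Canonical young_group m mu := [group of young m mu].

(* xi^{+k}, extended by the identity to a permutation of 'I_n; this is only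
   meant for k + m <= n (otherwise the formula need not define a permutation,
   and the value is then the identity). *)
Definition shift_fun (m n k : nat) (xi : sym m) : {ffun 'I_n -> 'I_n} :=
  [ffun i : 'I_n =>
     if (insub (i - k)%N : option 'I_m) is Some j then
       if (k <= i)%N then insubd i (xi j + k)%N else i
     else i].
Definition shift_perm (m n k : nat) (xi : sym m) : sym n :=
  insubd (1%g : 'S_n) (shift_fun n k xi).

Section Shift.
Variables (m n k : nat).
Hypothesis le_km : (k + m <= n)%N.
Implicit Types xi : sym m.

Lemma shift_fun_in xi (i : 'I_n) (j : 'I_m) :
  i = (j + k)%N :> nat -> shift_fun n k xi i = (xi j + k)%N :> nat.
Proof.
move=> ei; rewrite ffunE ei addnK valK leq_addl insubdK //.
by rewrite -topredE /= addnC (leq_trans _ le_km) // ltn_add2l.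
Qed.

Lemma shift_fun_out xi (i : 'I_n) :
  (forall j : 'I_m, i <> (j + k)%N :> nat) -> shift_fun n k xi i = i.
Proof.
move=> oi; rewrite ffunE; case: insubP => // j _ ej.
by case: leqP => // le_ki; case: (oi j); rewrite ej subnK.
Qed.

Lemma shift_splitP (i : 'I_n) :
  (exists j : 'I_m, i = (j + k)%N :> nat)
  \/ (forall j : 'I_m, i <> (j + k)%N :> nat).
Proof.
have [le_ki|lt_ik] := leqP k i; last first.
  by right=> j ei; move: lt_ik; rewrite ei ltnNge leq_addl.
have [lt_im|le_mi] := ltnP (i - k) m.
  by left; exists (Ordinal lt_im); rewrite /= subnK.
by right=> j ei; move: le_mi; rewrite ei addnK leqNgt ltn_ord.
Qed.

Lemma shift_fun_inj xi : injective (shift_fun n k xi).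
Proof.
apply: (can_inj (g := shift_fun n k (xi^-1)%g)) => i.
have [[j ei]|oi] := shift_splitP i; last by rewrite !shift_fun_out.
apply: ord_inj; rewrite (shift_fun_in _ (shift_fun_in xi ei)).
by rewrite symK ei.
Qed.

Lemma shift_permE xi i : shift_perm n k xi i = shift_fun n k xi i.
Proof.
rewrite /shift_perm -pvalE.
have -> // : val (insubd (1%g : 'S_n) (shift_fun n k xi)) = shift_fun n k xi.
by apply: insubdK; apply/injectiveP/shift_fun_inj.
Qed.

Lemma shift_perm_in xi (i : 'I_n) (j : 'I_m) :
  i = (j + k)%N :> nat -> shift_perm n k xi i = (xi j + k)%N :> nat.
Proof. by rewrite shift_permE; apply: shift_fun_in. Qed.

Lemma shift_perm_out xi (i : 'I_n) :
  (forall j : 'I_m, i <> (j + k)%N :> nat) -> shift_perm n k xi i = i.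
Proof. by rewrite shift_permE; apply: shift_fun_out. Qed.

Lemma shift_permM xi xi' :
  shift_perm n k (xi * xi')%g = (shift_perm n k xi * shift_perm n k xi')%g.
Proof.
apply/symP=> i; rewrite symM.
have [[j ei]|oi] := shift_splitP i; last by rewrite !shift_perm_out.
apply: ord_inj; rewrite (shift_perm_in _ ei) symM.
by rewrite (shift_perm_in xi (shift_perm_in xi' ei)).
Qed.

Lemma shift_perm1 : shift_perm n k (1 : sym m)%g = 1%g.
Proof.
by apply: (mulgI (shift_perm n k (1 : sym m)%g)); rewrite -shift_permM !mulg1.
Qed.

Lemma shift_permV xi : shift_perm n k (xi^-1)%g = (shift_perm n k xi)^-1%g.
Proof.
apply: (mulgI (shift_perm n k xi)).
by rewrite -shift_permM !mulgV shift_perm1.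
Qed.

Lemma shift_perm_inj : injective (@shift_perm m n k).
Proof.
move=> xi xi' e; apply/symP=> j.
have lt_jn : (j + k < n)%N.
  by rewrite addnC (leq_trans _ le_km) // ltn_add2l.
have ei : Ordinal lt_jn = (j + k)%N :> nat by [].
have := shift_perm_in xi ei; rewrite e (shift_perm_in xi' ei).
by move/addIn/val_inj.
Qed.

End Shift.

Section Biyoung.
Variables (n : nat) (ab : bicomp n).
Local Notation al := (bc1 ab).
Local Notation be := (bc2 ab).
Local Notation a := (sumn (bc1 ab)).
Local Notation b := (sumn (bc2 ab)).

(* S_alpha, S_beta^{+|alpha|} and S_{alpha|beta} as subsets of S_n *)
Definition young1 : {set sym n} := [set shift_perm n 0 xi | xi in young a al].
Definition young2 : {set sym n} := [set shift_perm n a xi | xi in young b be].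
Definition biyoung : {set sym n} := (young1 * young2)%g.

Definition biyoung_elt (xa : sym a) (xb : sym b) : sym n :=
  (shift_perm n 0 xa * shift_perm n a xb)%g.

Fact bc_le1 : (0 + a <= n)%N.
Proof. by rewrite -[X in (_ <= X)%N](sumn_bc ab) leq_addr. Qed.
Fact bc_le2 : (a + b <= n)%N.
Proof. by rewrite sumn_bc. Qed.
Hint Resolve bc_le1 bc_le2 : core.

Lemma biyoungP x :
  reflect (exists xa xb, [/\ xa \in young a al, xb \in young b be
                           & x = biyoung_elt xa xb])
          (x \in biyoung).
Proof.
apply: (iffP mulsgP) => [[_ _ /imsetP[xa ya ->] /imsetP[xb yb ->] ->]|].
  by exists xa, xb.
case=> xa [xb [ya yb ->]].
by exists (shift_perm n 0 xa) (shift_perm n a xb) => //; apply: imset_f.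
Qed.

Implicit Types (xa : sym a) (xb : sym b).

Lemma biyoung_elt_comm xa xb :
  commute (shift_perm n 0 xa : sym n) (shift_perm n a xb).
Proof.
apply/symP=> i; rewrite !symM.
have [lt_ia|le_ai] := ltnP i a.
  have o2 (i' : 'I_n) : (i' < a)%N -> forall j : 'I_b, i' <> (j + a)%N :> nat.
    by move=> lt_i' j ei; move: lt_i'; rewrite ei ltnNge leq_addl.
  have ei : i = (Ordinal lt_ia + 0)%N :> nat by rewrite addn0.
  rewrite !(shift_perm_out _ xb) //; apply: o2 => //.
  by rewrite (shift_perm_in _ _ ei) // addn0.
have o1 (i' : 'I_n) : (a <= i')%N -> forall j : 'I_a, i' <> (j + 0)%N :> nat.
  by move=> le_i' j ei; move: le_i'; rewrite ei addn0 leqNgt ltn_ord.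
rewrite !(shift_perm_out _ xa) //; apply: o1 => //.
have [[j ei]|oi] := shift_splitP b a i; last by rewrite shift_perm_out.
by rewrite (shift_perm_in _ _ ei) // leq_addl.
Qed.

Lemma biyoung_eltM xa xb xa' xb' :
  biyoung_elt (xa * xa')%g (xb * xb')%g
  = (biyoung_elt xa xb * biyoung_elt xa' xb')%g.
Proof.
rewrite /biyoung_elt !shift_permM // !mulgA; congr (_ * _)%g.
by rewrite -!mulgA biyoung_elt_comm.
Qed.

Lemma biyoung_elt1 : biyoung_elt 1%g 1%g = 1%g.
Proof. by rewrite /biyoung_elt !shift_perm1 // mulg1. Qed.

Lemma biyoung_elt_young1 xa xb : biyoung_elt xa xb \in young1 -> xb = 1%g.
Proof.
case/imsetP=> xa' _ e.
have {}e : shift_perm n a xb = shift_perm n 0 (xa^-1 * xa')%g.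
  by rewrite shift_permM // shift_permV // -e mulKg.
apply: (shift_perm_inj bc_le2); rewrite shift_perm1 //; apply/symP=> i.
have [[j ei]|oi] := shift_splitP b a i; last by rewrite sym1 shift_perm_out.
rewrite sym1 e shift_perm_out // => j'; rewrite ei addn0 => ej.
by have := ltn_ord j'; rewrite -ej ltnNge leq_addl.
Qed.

Fact biyoung_group_set : group_set biyoung.
Proof.
apply/group_setP; split=> [|x y].
  by apply/biyoungP; exists 1%g, 1%g; rewrite !group1 biyoung_elt1.
case/biyoungP=> xa [xb [ya yb ->]] /biyoungP[xa' [xb' [ya' yb' ->]]].
apply/biyoungP; exists (xa * xa')%g, (xb * xb')%g.
by rewrite !groupM // biyoung_eltM.
Qed.
Canonical biyoung_group := Group biyoung_group_set.

End Biyoung.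
Arguments biyoung_elt {n} ab xa xb.

Definition left_transversal (gT : finGroupType) (X H : {set gT}) :=
  is_transversal X (lcosets H [set: gT]) [set: gT].

Definition diagram (la : seq nat) : Type :=
  {i : 'I_(size la) & 'I_(nth 0%N la i)}.
HB.instance Definition _ la := Finite.on (diagram la).

Definition cell_row la (x : diagram la) : nat := tag x.
Definition cell_col la (x : diagram la) : nat := tagged x.

Lemma diagram_inj la (x y : diagram la) :
  cell_row x = cell_row y -> cell_col x = cell_col y -> x = y.
Proof.
case: x y => [i j] [i' j']; rewrite /cell_row /cell_col /= => /val_inj ii'.
by case: i' / ii' j' => j' /val_inj ->.
Qed.

Record tableau (n : nat) (la : seq nat) := Tableau {
  tab :> diagram la -> 'I_n;
  tab_inv : 'I_n -> diagram la;
  tabK : cancel tab tab_inv;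
  tab_invK : cancel tab_inv tab }.

Section Tableaux.
Variables (n : nat) (la : intpart n).
Implicit Types t u : tableau n la.

Definition row_stab t : {set sym n} := fibre_stab (fun i => cell_row (tab_inv t i)).
Definition col_stab t : {set sym n} := fibre_stab (fun i => cell_col (tab_inv t i)).

(* t o u^-1 *)
Fact tab_quo_inj t u : injective (fun i => t (tab_inv u i)).
Proof. exact: inj_comp (can_inj (tabK t)) (can_inj (tab_invK u)). Qed.
Definition tab_quo t u : sym n := perm (@tab_quo_inj t u).

(* s o t *)
Fact tab_act_subproof1 (s : sym n) t :
  cancel (fun x => s (t x)) (fun i => tab_inv t (s^-1%g i)).
Proof. by move=> x; rewrite symK tabK. Qed.
Fact tab_act_subproof2 (s : sym n) t :
  cancel (fun i => tab_inv t (s^-1%g i)) (fun x => s (t x)).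
Proof. by move=> i; rewrite tab_invK symKV. Qed.
Definition tab_act (s : sym n) t : tableau n la :=
  Tableau (@tab_act_subproof1 s t) (@tab_act_subproof2 s t).

Fact init_tab_subproof (x : diagram la) :
  (flatten_index la (cell_row x) (cell_col x) < n)%N.
Proof.
by rewrite (leq_trans (flatten_indexP (ltn_ord (tagged x)))) // sumn_parts.
Qed.
Fact init_row_subproof (i : 'I_n) : (reshape_index la i < size la)%N.
Proof. by apply: reshape_indexP; rewrite sumn_parts. Qed.
Fact init_col_subproof (i : 'I_n) :
  (reshape_offset la i < nth 0%N la (Ordinal (init_row_subproof i)))%N.
Proof. by apply: reshape_offsetP; rewrite sumn_parts. Qed.
Definition init_tab_fun (x : diagram la) : 'I_n := Ordinal (init_tab_subproof x).
Definition init_tab_inv (i : 'I_n) : diagram la :=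
  Tagged (fun j : 'I_(size la) => 'I_(nth 0%N la j)) (Ordinal (init_col_subproof i)).
Fact init_tab_invK : cancel init_tab_inv init_tab_fun.
Proof. by move=> i; apply: val_inj; rewrite /= reshape_indexK. Qed.
Fact init_tabK : cancel init_tab_fun init_tab_inv.
Proof.
move=> x; apply: diagram_inj; rewrite /cell_row /cell_col /=.
  exact: flatten_indexKl (ltn_ord (tagged x)).
exact: flatten_indexKr (ltn_ord (tagged x)).
Qed.
Definition init_tab : tableau n la := Tableau init_tabK init_tab_invK.

Lemma tab_quo_act (s : sym n) t u : tab_quo (tab_act s t) u = (s * tab_quo t u)%g.
Proof. by apply/symP=> i; rewrite symM !permE. Qed.

Lemma col_stab_act (s : sym n) t :
  col_stab (tab_act s t) = (col_stab t :^ s^-1)%g.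
Proof.
apply/setP=> x; rewrite mem_conjgV !inE; apply/forallP/forallP=> fx i /=.
  by have := fx (s i); rewrite /= symK conjgE !symM.
have := fx (s^-1%g i); rewrite conjgE !symM symKV.
by [].
Qed.

Definition polytabloid_vec t : perm_module (young n la) :=
  \sum_(s in col_stab t) pm_basis (young n la) (s * tab_quo t init_tab)%g *~ sgn s.

Definition specht_pred : {pred perm_module (young n la)} :=
  Zspan (fun v => exists t, v = polytabloid_vec t).

Lemma scale_polytabloid_vec (g : sym n) t :
  gr_elt g *: polytabloid_vec t = polytabloid_vec (tab_act g t).
Proof.
rewrite scaler_sumr /polytabloid_vec col_stab_act.
rewrite [RHS](reindex_inj (conjg_inj g^-1%g)) /=.
apply: eq_big => s; first by rewrite memJ_conjg.
move=> _; rewrite -scalerMzr scale_pm_basis.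
by rewrite sgnJ tab_quo_act conjgE invgK !mulgA mulgKV.
Qed.

Fact specht_submod_closed : submod_closed specht_pred.
Proof.
apply: Zspan_submod_closed => g _ [t ->].
by exists (tab_act g t); rewrite scale_polytabloid_vec.
Qed.
HB.instance Definition _ := GRing.isSubmodClosed.Build (group_ring (sym n))
  (perm_module (young n la)) specht_pred specht_submod_closed.

Record specht := Specht {
  specht_val :> perm_module (young n la);
  specht_valP : specht_val \in specht_pred }.
HB.instance Definition _ := [isSub for specht_val].
HB.instance Definition _ := [Choice of specht by <:].
HB.instance Definition _ := [SubChoice_isSubLmodule of specht by <:].

Fact polytabloid_subproof t : polytabloid_vec t \in specht_pred.
Proof. by apply: mem_Zspan; exists t. Qed.
Definition polytabloid t : specht := Specht (polytabloid_subproof t).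

End Tableaux.

Section SignedPermutationModule.
Variables (n : nat) (ab : bicomp n).
Local Notation al := (bc1 ab).
Local Notation be := (bc2 ab).
Local Notation ZS := (group_ring (sym n)).

(* The induced module is the tensor product of ZS_n with the rank one module
   (trivial) (x) (sign) over the group ring of S_{alpha|beta}, that is, the
   quotient of ZS_n by the span of the relations below. *)
Definition sp_relator (v : ZS) : Prop :=
  exists x xa xb, [/\ xa \in young (sumn al) al, xb \in young (sumn be) be
    & v = gr_elt (x * biyoung_elt ab xa xb)%g - gr_elt x *~ sgn xb].

Fact sp_relations_closed : submod_closed (Zspan sp_relator : {pred ZS^o}).
Proof.
apply: Zspan_submod_closed => g _ [x [xa [xb [ya yb ->]]]].
exists (g * x)%g, xa, xb; split=> //.
by rewrite scalerBr -scalerMzr -mulgA !gr_eltM.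
Qed.

Local Notation Q := {ideal_quot (Zspan sp_relator)}.

Definition signed_perm_module : Type := Q.
HB.instance Definition _ := GRing.Zmodule.on signed_perm_module.

Definition sp_pi (v : ZS) : signed_perm_module := (\pi_Q v)%qT.

Lemma sp_piE u v : (sp_pi u == sp_pi v) = (u - v \in Zspan sp_relator).
Proof. by rewrite Quotient.idealrBE. Qed.

Fact sp_pi_is_zmod_morphism : zmod_morphism sp_pi.
Proof. exact: raddfB. Qed.
HB.instance Definition _ := GRing.isZmodMorphism.Build ZS signed_perm_module
  sp_pi sp_pi_is_zmod_morphism.

Definition sp_act (g : sym n) (q : signed_perm_module) : signed_perm_module :=
  sp_pi (gr_elt g * generic_quotient.repr (q : Q)).

Lemma sp_act_pi g v : sp_act g (sp_pi v) = sp_pi (gr_elt g * v).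
Proof.
apply/eqP; rewrite sp_piE -mulrBr.
have [_ /(_ (gr_elt g) _ 0)] := sp_relations_closed.
move=> /(_ (generic_quotient.repr (sp_pi v : Q) - v)).
rewrite addr0; apply; last exact: rpred0.
by rewrite -sp_piE /sp_pi reprK.
Qed.

Lemma sp_piP (q : signed_perm_module) : exists v, q = sp_pi v.
Proof. by exists (generic_quotient.repr (q : Q)); rewrite /sp_pi reprK. Qed.

Fact sp_act1 : sp_act 1%g =1 id.
Proof. by move=> q; have [v ->] := sp_piP q; rewrite sp_act_pi mul1r. Qed.
Fact sp_actM g h q : sp_act (g * h)%g q = sp_act g (sp_act h q).
Proof.
by have [v ->] := sp_piP q; rewrite !sp_act_pi gr_eltM mulrA.
Qed.
Fact sp_actD g : {morph sp_act g : p q / p + q}.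
Proof.
move=> p q; have [u ->] := sp_piP p; have [v ->] := sp_piP q.
by rewrite -raddfD !sp_act_pi mulrDr raddfD.
Qed.
HB.instance Definition _ := Zmodule_isGroupRingModule.Build (sym n)
  signed_perm_module sp_act1 sp_actM sp_actD.

(* the image of x (x) 1 (x) epsilon *)
Definition sp_elt (x : sym n) : signed_perm_module := sp_pi (gr_elt x).

Lemma scale_sp_elt g x : gr_elt g *: sp_elt x = sp_elt (g * x)%g.
Proof.
transitivity (sp_act g (sp_elt x)).
  exact: (sum_gr_elt (fun h => sp_act h (sp_elt x))).
by rewrite sp_act_pi -gr_eltM.
Qed.

Lemma sp_elt_biyoung x xa xb :
  xa \in young (sumn al) al -> xb \in young (sumn be) be ->
  sp_elt (x * biyoung_elt ab xa xb)%g = sp_elt x *~ sgn xb.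
Proof.
move=> ya yb; rewrite -raddfMz; apply/eqP; rewrite sp_piE.
by apply: mem_Zspan; exists x, xa, xb.
Qed.

End SignedPermutationModule.

Section Coefficients.
Variables (n : nat) (la : intpart n) (ab : bicomp n) (t0 : tableau n la).
Local Notation al := (bc1 ab).
Local Notation be := (bc2 ab).

Definition calR : {set sym n} :=
  [set d | (row_stab t0 :^ d :&: biyoung ab)%g \subset young1 ab].

Definition dbl_coset (d : sym n) : {set sym n} :=
  (row_stab t0 * [set d] * biyoung ab)%g.

(* epsilon_d x is read off an arbitrary factorization of x; [epsE] shows that
   the choice is irrelevant if d is in calR.  The value 0 is only a default
   outside the double coset. *)
Definition eps (d x : sym n) : int :=
  if [pick p : sym n * sym (sumn al) * sym (sumn be) |
        [&& p.1.1 \in row_stab t0, p.1.2 \in young _ al, p.2 \in young _ be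
          & x == (p.1.1 * d * biyoung_elt ab p.1.2 p.2)%g]] is Some p
  then sgn p.2 else 0.

Lemma epsE d tau xa xb :
  d \in calR -> tau \in row_stab t0 ->
  xa \in young (sumn al) al -> xb \in young (sumn be) be ->
  eps d (tau * d * biyoung_elt ab xa xb)%g = sgn xb.
Proof.
rewrite inE => /subsetP dR tR ya yb; rewrite /eps.
case: pickP => [[[tau' xa'] xb'] /= | /(_ (tau, xa, xb))]; last first.
  by rewrite /= tR ya yb eqxx.
case/and4P=> tR' ya' yb' /eqP e.
suff /biyoung_elt_young1 e1 :
    biyoung_elt ab (xa * xa'^-1)%g (xb * xb'^-1)%g \in young1 ab.
  by rewrite -(mulgKV xb' xb) e1 mul1g.
apply: dR; rewrite inE; apply/andP; split; last first.
  by apply/biyoungP; exists (xa * xa'^-1)%g, (xb * xb'^-1)%g; rewrite !groupM ?groupV.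
rewrite mem_conjg.
have eV : biyoung_elt ab xa'^-1%g xb'^-1%g = (biyoung_elt ab xa' xb')^-1%g.
  by apply: (mulgI (biyoung_elt ab xa' xb')); rewrite -biyoung_eltM !mulgV biyoung_elt1.
have -> : (biyoung_elt ab (xa * xa'^-1) (xb * xb'^-1) ^ d^-1 = tau^-1 * tau')%g.
  rewrite biyoung_eltM eV conjgE invgK.
  move: (biyoung_elt ab xa xb) (biyoung_elt ab xa' xb') e => z z' e.
  by apply: (mulgI tau); rewrite mulKVg !mulgA e !mulgK.
by rewrite groupM ?groupV.
Qed.

Definition acoef (x d : sym n) : int :=
  \sum_(s in col_stab t0 | (s * x)%g \in dbl_coset d) sgn s * eps d (s * x)%g.

End Coefficients.

(* Main.v *)
(** The map is the restriction to the Specht module of a homomorphism defined on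
    the whole permutation module.  Extend eps_d by zero outside the double coset
    R_{t0} d S_{alpha|beta}.  It is then invariant under left multiplication by
    R_{t0}, so sending the tabloid of t to the sum over g of
    eps_d (rho_t^-1 g) (g (x) 1 (x) epsilon) is well defined; and each summand
    depends only on the coset g S_{alpha|beta}, because the signs of eps_d and of
    g (x) 1 (x) epsilon cancel, so the sum does not depend on the transversal,
    which gives equivariance.  On e_t, conjugation by rho_t turns the sum over
    C_t into a sum over C_{t0}. *)

From HB Require Import structures.
Require Import Defs.
From mathcomp Require Import all_boot all_order all_fingroup all_algebra.

Set Implicit Arguments.
Unset Strict Implicit.
Unset Printing Implicit Defensive.

Import GroupScope GRing.Theory.
Local Open Scope ring_scope.

Section PermutationModuleExtension.
Variables (gT : finGroupType) (H : {set gT}) (V : lmodType (group_ring gT)).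
Variable phi : gT -> V.
Hypothesis phi_coset : forall x y, (x *: H = y *: H)%g -> phi x = phi y.
Hypothesis phi_act : forall g x, gr_elt g *: phi x = phi (g * x)%g.

(** The default [1] is never reached: each element of [left_coset H] is some [x *: H]. *)
Let rep (A : left_coset H) : gT := odflt 1%g [pick x | val A == (x *: H)%g].

Let val_rep A : val A = (rep A *: H)%g.
Proof.
rewrite /rep; case: pickP => [x /eqP //|no]; have /lcosetsP[x _ e] := valP A.
by have := no x; rewrite e eqxx.
Qed.

Definition pm_ext (f : perm_module H) : V := \sum_A phi (rep A) *~ f A.

Lemma pm_ext_basis x : pm_ext (pm_basis H x) = phi x.
Proof.
rewrite /pm_ext (bigD1 (coset_of_elt H x)) //= big1 => [|A nA].
  by rewrite ffunE eqxx addr0; apply: phi_coset; rewrite -val_rep.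
by rewrite ffunE (negPf nA).
Qed.

Fact pm_ext_zmod_morphism : zmod_morphism pm_ext.
Proof.
by move=> u v; rewrite /pm_ext -sumrB; apply: eq_bigr => A _; rewrite !ffunE mulrzBr.
Qed.

HB.instance Definition _ :=
  GRing.isZmodMorphism.Build (perm_module H) V pm_ext pm_ext_zmod_morphism.

Lemma perm_module_sumE (f : perm_module H) :
  f = \sum_A pm_basis H (rep A) *~ f A.
Proof.
apply/ffunP=> B; rewrite sum_ffunE (bigD1 B) //= big1 => [|A nA].
  rewrite ffunMzE ffunE addr0 (_ : B == _); first by rewrite -mulrzr mul1r intz.
  by apply/eqP/val_inj; rewrite /= -val_rep.
rewrite ffunMzE ffunE (_ : (B == _) = false) ?mul0rz //.
by apply: contraNF nA => /eqP ->; apply/eqP/val_inj; rewrite /= -val_rep.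
Qed.

(** Expanding [a] over group elements and [f] over basis cosets reduces this to [phi_act]. *)
Fact pm_ext_scalable : scalable pm_ext.
Proof.
move=> a f; rewrite gr_scaleE raddf_sum [RHS]gr_scaleE; apply: eq_bigr => g _.
rewrite raddfMz /=; congr (_ *~ _).
rewrite [f in LHS]perm_module_sumE scaler_sumr raddf_sum [in RHS]/pm_ext scaler_sumr.
apply: eq_bigr => A _; rewrite -!scalerMzr raddfMz /= scale_pm_basis.
by rewrite pm_ext_basis phi_act.
Qed.

HB.instance Definition _ :=
  GRing.isScalable.Build (group_ring gT) (perm_module H) V *:%R pm_ext pm_ext_scalable.

Lemma perm_module_ext :
  exists Phi : {linear perm_module H -> V}, forall x, Phi (pm_basis H x) = phi x.
Proof. by exists pm_ext => x; apply: pm_ext_basis. Qed.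

End PermutationModuleExtension.

Section TransversalSums.
Variables (gT : finGroupType) (H : {group gT}) (V : zmodType) (F : gT -> V).
Hypothesis F_coset : forall x h, h \in H -> F (x * h)%g = F x.
Variable X : {set gT}.
Hypothesis X_transversal : left_transversal X H.

(** [X] meets each left coset once and [F] is constant on cosets, so [repr] may replace the chosen
    representatives. *)
Lemma sum_left_transversal :
  \sum_(x in X) F x = \sum_(A in lcosets H [set: gT]) F (repr A).
Proof.
have [partP _ _] := and3P X_transversal.
have [_ tiP _] := and3P partP.
have inX x : (x *: H)%g \in lcosets H [set: gT] by apply/lcosetsP; exists x.
have pbl x : pblock (lcosets H [set: gT]) x = (x *: H)%g.
  by apply: def_pblock => //; rewrite lcoset_refl.
have -> : lcosets H [set: gT] = [set (x *: H)%g | x in X].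
  by rewrite -(pblock_transversal X_transversal); apply: eq_imset.
rewrite big_imset /=; last first.
  move=> x y xX yX e; apply: (pblock_inj X_transversal) => //.
  by rewrite !pbl.
apply: eq_bigr => x _; have /lcosetP[h hH ->] := mem_repr _ (lcoset_refl H x).
by rewrite F_coset.
Qed.

End TransversalSums.

(** Both sums are rewritten over cosets, which [A -> g *: A] permutes. *)
Lemma sum_left_transversal_shift (gT : finGroupType) (H : {group gT})
    (V : zmodType) (F : gT -> V) (X : {set gT}) g :
  (forall x h, h \in H -> F (x * h)%g = F x) -> left_transversal X H ->
  \sum_(x in X) F (g * x)%g = \sum_(x in X) F x.
Proof.
move=> F_coset trX; rewrite !(@sum_left_transversal _ H) // => [|x h hH]; last first.
  by rewrite mulgA (F_coset _ h).
rewrite [RHS](reindex_inj (can_inj (lcosetK g))) /=.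
have memg A : ((g *: A)%g \in lcosets H [set: gT]) = (A \in lcosets H [set: gT]).
  apply/lcosetsP/lcosetsP=> [][x _ e].
    by exists (g^-1 * x)%g => //; rewrite lcosetM -e lcosetK.
  by exists (g * x)%g => //; rewrite e lcosetM.
apply: eq_big => A; first by rewrite memg.
case/lcosetsP=> x _ ->; rewrite -lcosetM.
have /lcosetP[h hH ->] := mem_repr _ (lcoset_refl H x).
have /lcosetP[k kH ->] := mem_repr _ (lcoset_refl H (g * x)%g).
by rewrite mulgA (F_coset _ k) ?(F_coset _ h).
Qed.

Lemma fibre_stab_conj n (T : eqType) (f : 'I_n -> T) (s u : sym n) :
  s \in fibre_stab f -> (s ^ u)%g \in fibre_stab (fun i => f (u i)).
Proof.
rewrite !inE => /forallP fs; apply/forallP=> i.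
by rewrite conjgE !symM symKV.
Qed.

Section Quotients.
Variables (n : nat) (la : intpart n).
Implicit Types t u v : tableau n la.

Lemma tab_quoM t u v : (tab_quo t u * tab_quo u v)%g = tab_quo t v.
Proof. by apply/symP=> i; rewrite symM !permE /= tabK. Qed.

Lemma tab_quo1 t : tab_quo t t = 1%g.
Proof. by apply/symP=> i; rewrite permE sym1 tab_invK. Qed.

Lemma tab_quoV t u : (tab_quo t u)^-1%g = tab_quo u t.
Proof. by apply/eqP; rewrite eq_invg_mul tab_quoM tab_quo1. Qed.

Lemma tab_inv_quo t u i : tab_inv t (tab_quo t u i) = tab_inv u i.
Proof. by rewrite permE tabK. Qed.

(** The permutation [tab_quo t u] carries the rows of [u] to those of [t], so conjugating by it
    pulls the row stabilizer back. *)
Lemma row_stab_quo t u s :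
  s \in row_stab t -> (s ^ tab_quo t u)%g \in row_stab u.
Proof.
move=> /(@fibre_stab_conj _ _ _ _ (tab_quo t u)); rewrite !inE.
by under eq_forallb => i do rewrite !tab_inv_quo.
Qed.

Lemma col_stab_quo t u s :
  s \in col_stab t -> (s ^ tab_quo t u)%g \in col_stab u.
Proof.
move=> /(@fibre_stab_conj _ _ _ _ (tab_quo t u)); rewrite !inE.
by under eq_forallb => i do rewrite !tab_inv_quo.
Qed.

Lemma mem_col_stab_quo t u s :
  ((s ^ tab_quo t u)%g \in col_stab u) = (s \in col_stab t).
Proof.
apply/idP/idP=> [/(col_stab_quo t)|]; last exact: col_stab_quo.
by rewrite -(tab_quoV t u) conjgK.
Qed.

End Quotients.

Section Epsilon.
Variables (n : nat) (la : intpart n) (ab : bicomp n) (t0 : tableau n la).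
Variable d : sym n.
Hypothesis dR : d \in calR ab t0.
Local Notation eps := (eps ab t0 d).
Local Notation D := (dbl_coset ab t0 d).

Lemma dbl_cosetP x :
  reflect (exists tau xa xb,
             [/\ tau \in row_stab t0, xa \in young _ (bc1 ab), xb \in young _ (bc2 ab)
               & x = (tau * d * biyoung_elt ab xa xb)%g])
          (x \in D).
Proof.
apply: (iffP mulsgP) => [[y z]|[tau [xa [xb [tR ya yb ->]]]]].
  case/rcosetP=> tau tR -> /biyoungP[xa [xb [ya yb ->]]] ->.
  by exists tau, xa, xb.
exists (tau * d)%g (biyoung_elt ab xa xb) => //.
  by rewrite mem_rcoset mulgK.
by apply/biyoungP; exists xa, xb.
Qed.

Lemma eps_out x : x \notin D -> eps x = 0.
Proof.
rewrite /Defs.eps; case: pickP => // [[[tau xa] xb]] /= /and4P[tR ya yb /eqP ->].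
by case/negP; apply/dbl_cosetP; exists tau, xa, xb.
Qed.

(** On [D], the factor [tau] is absorbed into the row part of a factorization; off [D], both sides
    are zero, since [D] is stable under the row group. *)
Lemma epsMl tau x : tau \in row_stab t0 -> eps (tau * x)%g = eps x.
Proof.
move=> tR; case: (boolP (x \in D)) => [/dbl_cosetP[tau' [xa [xb [tR' ya yb ->]]]]|xD].
  by rewrite (mulgA tau) (mulgA tau) !epsE ?groupM.
rewrite !eps_out //; apply: contra xD => /dbl_cosetP[tau' [xa [xb [tR' ya yb e]]]].
apply/dbl_cosetP; exists (tau^-1 * tau')%g, xa, xb; split=> //.
  by rewrite groupM ?groupV.
by apply: (mulgI tau); rewrite e !mulgA mulgV mul1g.
Qed.

Lemma epsMr x xa xb : xa \in young _ (bc1 ab) -> xb \in young _ (bc2 ab) ->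
  eps (x * biyoung_elt ab xa xb)%g = eps x * sgn xb.
Proof.
move=> ya yb; case: (boolP (x \in D)) => [/dbl_cosetP[tau [xa' [xb' [tR ya' yb' ->]]]]|xD].
  by rewrite -mulgA -biyoung_eltM !epsE ?groupM // sgnM.
rewrite !eps_out ?mul0r //.
apply: contra xD => /dbl_cosetP[tau [xa' [xb' [tR ya' yb' e]]]].
apply/dbl_cosetP; exists tau, (xa' * xa^-1)%g, (xb' * xb^-1)%g.
split; rewrite ?groupM ?groupV //.
apply: (mulIg (biyoung_elt ab xa xb)).
by rewrite e -[RHS]mulgA -biyoung_eltM !mulgKV.
Qed.

Lemma acoefE x : acoef ab t0 x d = \sum_(s in col_stab t0) sgn s * eps (s * x)%g.
Proof.
rewrite /acoef [RHS](bigID (fun s => (s * x)%g \in D)) /= [X in _ + X]big1 ?addr0 //.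
by move=> s /andP[_ sD]; rewrite eps_out ?mulr0.
Qed.

(* sgn xb occurs twice and squares to 1 *)
Lemma sp_elt_eps_coset r x h : h \in biyoung ab ->
  sp_elt ab (x * h)%g *~ eps (r * (x * h))%g = sp_elt ab x *~ eps (r * x)%g.
Proof.
case/biyoungP=> xa [xb [ya yb ->]].
rewrite sp_elt_biyoung // mulgA epsMr // -mulrzA; congr (_ *~ _).
by rewrite mulrCA -{1}sgnV -sgnM mulVg sgn1 mulr1.
Qed.

End Epsilon.

Theorem theorem3p3 (n : nat) (n_gt0 : (0 < n)%N) (la : intpart n)
    (ab : bicomp n) (t0 : tableau n la) (Gam : {set sym n})
    (Gam_transversal : left_transversal Gam (biyoung ab))
    (d : sym n) (dR : d \in calR ab t0) :
  exists theta : {linear specht la -> signed_perm_module ab},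
    forall t : tableau n la,
      theta (polytabloid t) =
        \sum_(g in Gam)
          sp_elt ab g *~ acoef ab t0 ((tab_quo t t0)^-1 * g)%g d.
Proof.
(* The factor [w] passes from the initial tableau to [t0]: for [x = tab_quo t (init_tab la)], the
   product [x * w] is [tab_quo t t0]. *)
pose w := tab_quo (init_tab la) t0.
pose phi (x : sym n) : signed_perm_module ab :=
  \sum_(g in Gam) sp_elt ab g *~ eps ab t0 d ((x * w)^-1 * g)%g.
have phi_coset x y : (x *: young n la = y *: young n la)%g -> phi x = phi y.
  move=> e; have /lcosetP[r rY ->] : x \in (y *: young n la)%g.
    by rewrite -e lcoset_refl.
  apply: eq_bigr => g _; congr (_ *~ _).
  have -> : ((y * r * w)^-1 * g = (r^-1 ^ w) * ((y * w)^-1 * g))%g.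
    by rewrite conjgE !invMg !mulgA mulgK.
  (* The Young subgroup of [la] is by definition the row stabilizer of [init_tab la], and
     conjugation by [w] moves it to that of [t0]. *)
  rewrite epsMl //; apply: (@row_stab_quo _ _ (init_tab la)).
  by rewrite groupV.
have phi_act g x : gr_elt g *: phi x = phi (g * x)%g.
  rewrite /phi scaler_sumr.
  (* Replacing the summation variable [y] by [g * y] makes [g] cancel inside [eps]. *)
  rewrite -[RHS](@sum_left_transversal_shift _ _ _ _ _ g _ Gam_transversal); last first.
    by move=> y h hB; apply: sp_elt_eps_coset.
  apply: eq_bigr => y _; rewrite -scalerMzr scale_sp_elt; congr (_ *~ _).
  by rewrite -(mulgA g) (invMg g) -(mulgA _ g^-1%g) mulKg.
have [Phi PhiE] := perm_module_ext phi_coset phi_act.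
exists (Phi \o (val : {linear specht la -> perm_module (young n la)})) => t.
rewrite /= /polytabloid_vec raddf_sum /=.
transitivity (\sum_(s in col_stab t) phi (s * tab_quo t (init_tab la))%g *~ sgn s).
  by apply: eq_bigr => s _; rewrite raddfMz /= PhiE.
transitivity (\sum_(s in col_stab t) \sum_(g in Gam)
    sp_elt ab g *~ (eps ab t0 d ((s * tab_quo t (init_tab la) * w)^-1 * g)%g * sgn s)).
  apply: eq_bigr => s _; rewrite /phi mulrz_suml; apply: eq_bigr => g _.
  by rewrite -mulrzA.
rewrite exchange_big; apply: eq_bigr => g _ /=.
(* With [rho = tab_quo t t0], the inverse of [s * rho] is [rho^-1 * s^-1], whereas [acoef] involves
   [sigma * rho^-1]. Hence [sigma] is the inverse of [s ^ rho], which has the same sign as [s]. *)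
rewrite acoefE -mulrz_sumr; congr (_ *~ _); rewrite [RHS](reindex_inj invg_inj) /=.
rewrite [RHS](reindex_inj (conjg_inj (tab_quo t t0))) /=.
apply: eq_big => s; first by rewrite groupV mem_col_stab_quo.
move=> _; rewrite -conjVg sgnJ sgnV mulrC; congr (_ * eps _ _ _ _).
by rewrite -(mulgA s) tab_quoM conjgE invMg !mulgA mulgK.
Qed.
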